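(* Let $n\ge 3$, $k\ge1$ be integers with $n\ge 2k$, let $m=\frac{n-2k}{n+2k}$, and let $\theta,\rho\in\mathbb{R}$ with $\theta>0$ and $2\theta+\rho>0$. For $\alpha>0$ let $u_\alpha>0$ be an admissible radially symmetric smooth solution on $\mathbb{R}^n$ with $u_\alpha(0)=\alpha$ of $$\sigma_k^{1/k}\left(D^{2}\big(u^{-\frac{2k}{n+2k}}\big)-\frac{u^{\frac{2k}{n+2k}}}{2}\big|D\big(u^{-\frac{2k}{n+2k}}\big)\big|^{2}I\right)=u^{\frac{2k}{n+2k}-1}\left[(2\theta+\rho)u+\frac{4k\theta}{n+2k}\,x\cdot Du\right].$$ Then the following holds as $|x|\to\infty$. (1) (Expander, $\rho<0$) $u_\alpha(x)=O\big(|x|^{-\frac{2}{1-m}-\delta}\big)$, where $\delta=\frac{\rho}{\theta(1-m)}$. (2) (Steady, $\rho=0$) If $n>2k$, then $u_\alpha(x)=O\left(\left[\frac{\ln|x|}{|x|^2}\right]^{\frac{1}{1-m}}\right)$. If $n=2k$, then $u_\alpha(x)=O\left(\frac{(\ln|x|)^{1-\frac2n}}{|x|^2}\right)$. (3) (Shrinker, $\rho>0$) - If $n>2k$ and $0<\rho\le 2\theta$, then solutions have a slow decay rate: $u_\alpha(x)=O\big(|x|^{-\frac{2}{1-m}}\big)$. - If $n>2k$ and $0<2\theta<\rho$, then either $u_\alpha(x)=O\big(|x|^{-\frac{2}{1-m}}\big)$ (slow decay) or $u_\alpha(x)=O\big(|x|^{-\frac{4}{1-m}}\big)$. - If $n=2k$,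 then $u_\alpha(x)=O\big(|x|^{-2(1+d)}\big)$ for some $0<d\le\min\{\frac{\rho}{2\theta},1\}$.
   Context: All derivatives and norms are Euclidean. For a symmetric matrix with eigenvalues $\lambda_1,\dots,\lambda_n$, $\sigma_k=\sum_{i_1<\dots<i_k}\lambda_{i_1}\cdots\lambda_{i_k}$. For $u>0$ put $g_u=u^{\frac{4k}{n+2k}}|dx|^2$; $A_g=\frac{1}{n-2}\left(\mathrm{Ric}_g-\frac{R_g}{2(n-1)}g\right)$ is the Schouten tensor and $\sigma_j(g):=\sigma_j(g^{-1}A_g)$. A solution $u$ is admissible if $\sigma_1(g_u),\dots,\sigma_k(g_u)>0$ everywhere. When $\theta>0$ and $2\theta+\rho>0$, such $u_\alpha$ exist for every $\alpha>0$. *)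

(* Defs.v *)
From HB Require Import structures.
From mathcomp Require Import all_boot all_order all_algebra.
From mathcomp Require Import all_classical all_reals all_analysis.
Import Order.TTheory GRing.Theory Num.Theory.
Import numFieldNormedType.Exports.

Set Implicit Arguments.
Unset Strict Implicit.
Unset Printing Implicit Defensive.

Local Open Scope classical_set_scope.
Local Open Scope ring_scope.

Section Euclidean.
Context {R : realType} {n : nat}.
Implicit Types (x y : 'rV[R]_n) (f : 'rV[R]_n -> R).

Definition dotv x y : R := \sum_i x 0 i * y 0 i.

(* The library norm `|x| on row vectors is the sup norm. *)
Definition enorm x : R := Num.sqrt (dotv x x).

Definition radially_symmetric f := forall x y, enorm x = enorm y -> f x = f y.

(* The filter of neighbourhoods of infinity: |x| -> oo. *)
Definition at_infty : set_system 'rV[R]_n :=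
  filter_from [set: R] (fun r => [set x | r < enorm x]).

#[global] Instance at_infty_filter : Filter at_infty.
Proof.
apply: filter_from_filter; first by exists 0.
move=> r s _ _; exists (Num.max r s) => // x /=.
by rewrite gt_max => /andP[].
Qed.

Canonical at_infty_filter_on := FilterType at_infty at_infty_filter.

Definition partial (i : 'I_n) f : 'rV[R]_n -> R :=
  fun x => 'D_(delta_mx 0 i) f x.

Definition grad f x : 'rV[R]_n := \row_i partial i f x.

Definition hess f x : 'M[R]_n := \matrix_(i, j) partial i (partial j f) x.

(* C^oo: every iterated partial derivative is differentiable everywhere. *)
Definition smooth f :=
  forall (s : seq 'I_n) x, differentiable (foldr partial f s) x.

End Euclidean.

Section SymmetricFunctions.
Context {R : realType} {n : nat}.
Implicit Types (l : 'rV[R]_n) (A : 'M[R]_n).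

Definition elem_sym (k : nat) l : R :=
  \sum_(I : {set 'I_n} | #|I| == k) \prod_(i in I) l 0 i.

(* The eigenvalues, repeated according to multiplicity, in some order.
   They exist whenever A is symmetric, or is the product of the inverse of a
   symmetric positive definite matrix and a symmetric matrix; the value is 0
   if the characteristic polynomial does not split over R. *)
Definition eigenvalues A : 'rV[R]_n :=
  xget 0 [set l : 'rV[R]_n | char_poly A = \prod_(i < n) ('X - (l 0 i)%:P)].

Definition sigma (k : nat) A : R := elem_sym k (eigenvalues A).

End SymmetricFunctions.

(* A metric on R^n is given by its matrix g_ij in the standard coordinates. *)
Section Riemannian.
Context {R : realType} {n : nat}.
Variable g : 'rV[R]_n -> 'M[R]_n.
Implicit Types (i j l p : 'I_n) (x : 'rV[R]_n).

(* christoffel l i j is Gamma^l_ij. *)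
Definition christoffel l i j x : R :=
  2^-1 * \sum_p invmx (g x) l p *
    (partial i (fun y => g y p j) x + partial j (fun y => g y p i) x
     - partial p (fun y => g y i j) x).

(* Sign convention: Ric > 0 on the round sphere. *)
Definition ricci x : 'M[R]_n := \matrix_(i, j)
  \sum_l (partial l (christoffel l i j) x - partial j (christoffel l i l) x
    + \sum_p (christoffel l l p x * christoffel p i j x
              - christoffel l j p x * christoffel p i l x)).

Definition scalar_curvature x : R := \tr (invmx (g x) *m ricci x).

Definition schouten x : 'M[R]_n :=
  (n%:R - 2)^-1 *:
    (ricci x - (scalar_curvature x / (2 * (n%:R - 1))) *: g x).

Definition sigma_curvature (j : nat) x : R :=
  sigma j (invmx (g x) *m schouten x).

End Riemannian.

Section Soliton.
Context {R : realType} {n : nat}.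
Variable k : nat.
Variable u : 'rV[R]_n -> R.

(* g_u = u^(4k/(n+2k)) |dx|^2 *)
Definition conformal_metric (x : 'rV[R]_n) : 'M[R]_n :=
  (u x `^ (4 * k%:R / (n%:R + 2 * k%:R)))%:M.

Definition admissible :=
  forall j : nat, (1 <= j <= k)%N ->
  forall x, 0 < sigma_curvature conformal_metric j x.

(* powR is only meaningful for nonnegative bases; for admissible u the base of
   the k-th root is sigma_k(g_u) times a positive function. *)
Definition soliton_equation (theta rho : R) :=
  let a : R := 2 * k%:R / (n%:R + 2 * k%:R) in
  let v := fun x => u x `^ (- a) in
  forall x,
    sigma k (hess v x - (u x `^ a / 2 * enorm (grad v x) ^+ 2)%:M) `^ k%:R^-1
    = u x `^ (a - 1) *
      ((2 * theta + rho) * u x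
       + 4 * k%:R * theta / (n%:R + 2 * k%:R) * dotv x (grad u x)).

End Soliton.

(* Main.v *)
(** Put [a = 2k/(n+2k)], [s = ln |x|] and [u = e^(-(xi + s)/a)], so that
    [g_u = e^(-2 xi) (ds^2 + g_S)] with [g_S] the round metric. With
    [zeta = xi'] the equation becomes
      [c ((1 - zeta^2)/2)^(k-1) (zeta' + beta (1 - zeta^2))
         = (e^(-2 xi) (rho - 2 theta zeta))^k],
    where [beta = (n-2k)/(2k)] and [c = C(n-1,k-1)]. Positive scalar curvature
    (superharmonicity of a power of [u]) gives [|zeta| <= 1], and [sigma_k > 0]
    gives [rho - 2 theta zeta > 0]. Hence
      [zeta' >= K (e^(-2 xi) (z0 - zeta))^k - beta], with [z0 = rho/(2 theta)],
    and every decay rate is a lower bound for [xi] which follows from this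
    inequality alone, because a suitable Lyapunov function cannot increase
    where it is large: [e^(-2 z0 s) (z0 - zeta)] for expanders,
    [-zeta e^(-2 lam xi)] for steady solitons, [-2 xi - eps zeta] for shrinkers.
    For shrinkers with [n > 2k] this always yields the slow rate, which is the
    weaker alternative of the dichotomy. When [n = 2k], a shrinker has [zeta]
    nondecreasing and eventually positive. *)
Require Import Defs.
From mathcomp Require Import all_boot all_order all_algebra.
From mathcomp Require Import all_classical all_reals all_analysis.
From mathcomp Require Import ring lra.
Import Order.TTheory GRing.Theory Num.Theory.
Import numFieldNormedType.Exports.
Local Open Scope classical_set_scope.
Local Open Scope ring_scope.

Set Implicit Arguments.
Unset Strict Implicit.
Unset Printing Implicit Defensive.

(** * Calculus on the real line: derivation rules, monotonicity and trapping *)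

Lemma is_derive_subf (R : realType) (V : normedModType R) (f g : V -> R) x v df dg :
  is_derive x v f df -> is_derive x v g dg ->
  is_derive x v (fun y => f y - g y) (df - dg).
Proof. exact: is_deriveB. Qed.

Lemma is_derive_scalef (R : realType) (V : normedModType R) (c : R) (f : V -> R) x v df :
  is_derive x v f df -> is_derive x v (fun y => c * f y) (c * df).
Proof. exact: is_deriveZ. Qed.

Lemma is_derive_oppf (R : realType) (f : R -> R) (x df : R) :
  is_derive x 1 f df -> is_derive x 1 (fun y => - f y) (- df).
Proof. exact: is_deriveN. Qed.

Lemma is_derive_expRf (R : realType) (f : R -> R) (x df : R) :
  is_derive x 1 f df ->
  is_derive x 1 (fun y => expR (f y)) (expR (f x) * df).
Proof. by move=> fx; apply: (is_derive1_comp (f := expR)). Qed.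

Lemma nonincreasing_derive (R : realType) (f df : R -> R) (a b : R) :
  (forall x : R, is_derive x 1 f (df x)) ->
  (forall x, a < x < b -> df x <= 0) -> a <= b -> f b <= f a.
Proof.
move=> Hf Hdf; rewrite le_eqVlt => /predU1P[->//|ab].
have [|c cab fE] := MVT (df := df) ab (fun x _ => Hf x).
  apply: continuous_subspaceT => x.
  by apply: differentiable_continuous; apply/derivable1_diffP; exact: ex_derive.
rewrite -subr_le0 fE mulr_le0_ge0 ?subr_ge0 ?(ltW ab)//.
by apply: Hdf; move: cab; rewrite in_itv.
Qed.

(* If [L s] exceeds [M], compare it with [L t], where [t] is the last time
   before [s] at which [L] is at most [M]. *)
Lemma trapping (R : realType) (L dL : R -> R) (K s0 s : R) :
  (forall x : R, is_derive x 1 L (dL x)) ->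
  (forall x, s0 <= x -> K <= L x -> dL x <= 0) -> s0 <= s ->
  L s <= Num.max (L s0) K.
Proof.
move=> HL HdL s0s; set M := Num.max _ _; rewrite leNgt; apply/negP => MLs.
pose A := `[s0, s] `&` (L @^-1` [set y | y <= M]).
have cL : continuous L.
  move=> x; apply: differentiable_continuous; apply/derivable1_diffP.
  exact: ex_derive.
have cA : closed A.
  apply: closedI; first exact: itv_closed.
  by apply: closed_comp => [x _|]; [exact: cL|exact: closed_le].
have As0 : A s0 by split => /=; rewrite ?in_itv/= ?lexx//= /M le_max lexx.
have hA : has_sup A.
  by split; [exists s0|exists s => x [/=]; rewrite in_itv/= => /andP[]].
have At : A (sup A).
  by have /= := closure_sup hA.1 hA.2; rewrite -(closure_id A).1.
have [/= + Lt] := At; rewrite in_itv/= => /andP[s0t ts].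
suff : L s <= L (sup A) by move=> /le_trans/(_ Lt); rewrite leNgt MLs.
(* No point strictly between [sup A] and [s] lies in [A], so [L] exceeds [M], hence [K], there and
   [HdL] applies. *)
apply: (nonincreasing_derive HL) => // x /andP[tx xs].
apply: HdL; first exact: le_trans (ltW tx).
have : ~ A x by move=> /(ub_le_sup hA.2); rewrite leNgt tx.
move=> nAx; rewrite leNgt; apply/negP => LxK; apply: nAx; split => /=.
  by rewrite in_itv/= (ltW xs) (le_trans s0t (ltW tx)).
by rewrite /M le_max (ltW LxK) orbT.
Qed.

(** * Euclidean norm, and derivatives of functions of [ln |x|] *)

Lemma dotvD (R : realType) n (x y : 'rV[R]_n) :
  dotv (x + y) (x + y) = dotv x x + 2 * dotv x y + dotv y y.
Proof.
rewrite /dotv mulr_sumr -!big_split/=; apply: eq_bigr => i _.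
by rewrite !mxE; ring.
Qed.

Lemma dotv_ge0 (R : realType) n (x : 'rV[R]_n) : 0 <= dotv x x.
Proof. by apply: sumr_ge0 => i _; rewrite -expr2 sqr_ge0. Qed.

Lemma dotv_gt0 (R : realType) n (x : 'rV[R]_n) : x != 0 -> 0 < dotv x x.
Proof.
move=> x0; rewrite lt_neqAle dotv_ge0 andbT eq_sym; apply: contra x0.
rewrite /dotv psumr_eq0; last by move=> i _; rewrite -expr2 sqr_ge0.
move=> /allP x0; apply/eqP/rowP => i; rewrite mxE; apply/eqP.
by have := x0 i (mem_index_enum _); rewrite -expr2 sqrf_eq0.
Qed.

Lemma enorm_gt0 (R : realType) n (x : 'rV[R]_n) : x != 0 -> 0 < enorm x.
Proof. by move=> /dotv_gt0; rewrite sqrtr_gt0. Qed.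

Lemma enorm_sqr (R : realType) n (x : 'rV[R]_n) : enorm x ^+ 2 = dotv x x.
Proof. by rewrite sqr_sqrtr ?dotv_ge0. Qed.

Lemma dotv_delta (R : realType) n (x : 'rV[R]_n) i : dotv x (delta_mx 0 i) = x 0 i.
Proof.
rewrite /dotv (bigD1 i)//= big1 => [|j ji]; rewrite !mxE ?eqxx ?mulr1 ?addr0//.
by rewrite (negbTE ji) mulr0.
Qed.

Lemma dotv_axis (R : realType) n (i : 'I_n) (r : R) :
  dotv (r *: delta_mx 0 i : 'rV[R]_n) (r *: delta_mx 0 i) = r ^+ 2.
Proof.
rewrite /dotv (bigD1 i)//= big1 => [|j ji]; rewrite !mxE ?eqxx ?addr0/=; first by ring.
by rewrite (negbTE ji) !mulr0.
Qed.

Lemma enorm_axis (R : realType) n (i : 'I_n) (r : R) :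
  0 <= r -> enorm (r *: delta_mx 0 i : 'rV[R]_n) = r.
Proof. by move=> r0; rewrite /enorm dotv_axis sqrtr_sqr ger0_norm. Qed.

(** The two difference quotients agree after a shift of the base point; directional derivatives thus
    reduce to calculus in one variable. *)
Lemma is_derive_line (R : realType) (V : normedModType R) (f : V -> R) (x v : V) d :
  is_derive (0 : R) 1 (fun h : R => f (h *: v + x)) d -> is_derive x v f d.
Proof.
move=> [Hd Hv].
have E : (fun h : R => h^-1 *: ((f \o shift x) (h *: v) - f x)) =
  (fun h : R => h^-1 *: (((fun h : R => f (h *: v + x)) \o shift 0) (h *: (1 : R))
     - (fun h : R => f (h *: v + x)) 0)).
  by apply/funext => h /=; rewrite addr0 scale0r add0r -[h *: 1]/(h * 1) mulr1.
by constructor; [rewrite /derivable E|rewrite /derive E].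
Qed.

Lemma near_neq0 (R : realType) n (x : 'rV[R]_n) : x != 0 -> \forall y \near x, y != 0.
Proof.
move=> x0; have : nbhs x (~` [set (0 : 'rV[R]_n)]).
  apply: open_nbhs_nbhs; split; last exact/eqP.
  by apply: closed_openC; apply: accessible_closed_set1; apply: hausdorff_accessible; exact: norm_hausdorff.
by apply: filterS => y /= /eqP.
Qed.

(** Along the line [h *: delta_mx 0 i + x] the squared norm is a quadratic polynomial in [h], so the
    one-variable chain rule through the square root and [ln] applies. *)
Lemma is_derive_radial (R : realType) n (G : R -> R) dG (x : 'rV[R]_n) i :
  x != 0 -> is_derive (ln (enorm x)) 1 G dG ->
  is_derive x (delta_mx 0 i : 'rV[R]_n) (fun y => G (ln (enorm y)))
    (x 0 i * (enorm x ^- 2 * dG)).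
Proof.
move=> x0 HG; apply: is_derive_line.
have E h : dotv (h *: delta_mx 0 i + x) (h *: delta_mx 0 i + x)
   = dotv x x + (2 * x 0 i) * h + h ^+ 2.
  rewrite addrC dotvD dotv_axis (_ : dotv x (h *: _) = h * x 0 i); first by ring.
  by rewrite -dotv_delta /dotv mulr_sumr; apply: eq_bigr => j _; rewrite !mxE; ring.
have D0 := dotv_gt0 x0.
rewrite (_ : (fun h => _) = G \o (@ln R) \o (fun h => Num.sqrt (dotv x x + (2 * x 0 i) * h + h ^+ 2))); last first.
  by apply/funext => h /=; rewrite /enorm E.
have z0 : dotv x x + 2 * x 0 i * 0 + 0 ^+ 2 = dotv x x by rewrite mulr0 expr0n/= !addr0.
have H1 : is_derive (0 : R) 1 (fun h : R => dotv x x + (2 * x 0 i) * h + h ^+ 2) (2 * x 0 i).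
  by apply: is_derive_eq; rewrite /GRing.scale/=; ring.
have H2 : is_derive (0 : R) 1 (fun h => Num.sqrt (dotv x x + (2 * x 0 i) * h + h ^+ 2)) ((2 * enorm x)^-1 * (2 * x 0 i)).
  apply: (is_derive1_comp (f := @Num.sqrt R)) => //; rewrite z0.
  exact: is_derive1_sqrt.
have H3 : is_derive (0 : R) 1 (@ln R \o (fun h => Num.sqrt (dotv x x + (2 * x 0 i) * h + h ^+ 2)))
   ((enorm x)^-1 * ((2 * enorm x)^-1 * (2 * x 0 i))).
  apply: is_derive1_comp; rewrite z0; apply: is_derive1_ln.
  by rewrite sqrtr_gt0.
apply: is_derive_eq.
  apply: (is_derive1_comp (f := G) _ H3) => /=.
  by rewrite z0; exact: HG.
have := enorm_gt0 x0 => e0; field; rewrite gt_eqF//.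
Qed.

(** A derivative depends on the germ only, and the complement of the origin, where [ln |y|] is
    meaningful, is open. *)
Lemma partial_ext (R : realType) n (f g : 'rV[R]_n -> R) x i :
  x != 0 -> (forall y, y != 0 -> f y = g y) -> partial i f x = partial i g x.
Proof.
move=> x0 fg; apply: near_eq_derive.
by near=> y; apply: fg; near: y; exact: near_neq0.
Unshelve. all: by end_near. Qed.

(** * Elementary symmetric functions of a spectrum *)

(** Vieta's formula. It shows that [sigma] depends only on the characteristic polynomial and not on
    the ordering picked by [eigenvalues]. *)
Lemma elem_sym_coef (R : realType) n k (l : 'rV[R]_n) : (k <= n)%N ->
  elem_sym k l = (-1) ^+ k * (\prod_(i < n) ('X - (l 0 i)%:P))`_(n - k).
Proof.
move=> kn.
rewrite (eq_bigr (fun i => (- l 0 i)%:P + 'X)) => [|i _]; last first.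
  by rewrite addrC polyCN.
(* The expansion is indexed by the set [I] of factors that contribute their constant; its term has
   degree [n - #|I|], so only [#|I| = k] survives. *)
rewrite bigA_distr coef_sum mulr_sumr /elem_sym big_mkcond/=; apply: eq_bigr => I _.
have -> : \prod_i (if i \in I then (- l 0 i)%:P else 'X) =
    ((-1) ^+ #|I| * \prod_(i in I) l 0 i)%:P * 'X^(n - #|I|).
  rewrite (bigID (mem I))/=; congr (_ * _).
    rewrite -prodrN rmorph_prod/=; apply: eq_bigr => i iI; first by rewrite iI.
  rewrite (eq_bigr (fun=> 'X)) => [|i /negbTE->//].
  rewrite prodr_const; congr ('X^_).
  have := cardC (mem I); rewrite card_ord => In.
  transitivity #|[predC I]|; first by apply: eq_card => i; rewrite !inE.
  exact: canRL (addKn _) In.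
rewrite coefCM coefXn.
have In : (#|I| <= n)%N by rewrite -[X in (_ <= X)%N](card_ord n) max_card.
rewrite eqn_sub2lE// eq_sym; case: eqP => [->|_]; last by rewrite mulr0 mulr0.
by rewrite mulr1 mulrA -exprMn mulrNN mulr1 expr1n mul1r.
Qed.

Lemma sigma_diag (R : realType) n k (d : 'rV[R]_n) : (k <= n)%N ->
  sigma k (diag_mx d) = elem_sym k d.
Proof.
move=> kn; have E : char_poly (diag_mx d) = \prod_(i < n) ('X - (d 0 i)%:P).
  rewrite char_poly_trig ?diag_mx_is_trig//; apply: eq_bigr => i _.
  by rewrite mxE eqxx.
rewrite /sigma /eigenvalues.
(* The default of [xget] is excluded because [d] itself qualifies; any other choice [l] has the same
   product of linear factors. *)
case: xgetP => [l _ /= El|/(_ d)//].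
by rewrite !elem_sym_coef// -El E.
Qed.

(* [elem_sym j] of the spectrum with [p] once and [q] repeated [n - 1] times *)
Definition sym_axial {R : realType} (n j : nat) (p q : R) : R :=
  'C(n.-1, j)%:R * q ^+ j + 'C(n.-1, j.-1)%:R * (p * q ^+ j.-1).

(** The subsets of size [j] are split according to whether they contain [i0], in which case they
    contribute one factor [p]. *)
Lemma elem_sym_axial (R : realType) n j (i0 : 'I_n) (p q : R) : (0 < j)%N ->
  elem_sym j (\row_i if i == i0 then p else q) = sym_axial n j p q.
Proof.
move=> j0; rewrite /elem_sym (bigID (fun I : {set 'I_n} => i0 \in I))/= addrC.
have C1 : #|[set~ i0]%SET| = n.-1 by rewrite cardsC1 card_ord.
have card1 : #|[set I : {set 'I_n} | (#|I| == j) && (i0 \notin I)]%SET| = 'C(n.-1, j).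
  rewrite -C1 -cards_draws; apply: eq_card => I; rewrite !inE andbC.
  congr (_ && _); apply/idP/fintype.subsetP => [i0I i iI|/(_ i0)].
    by rewrite !inE; apply: contraNneq i0I => <-.
  by rewrite !inE eqxx/= => H; apply/negP => /H.
have card2 : #|[set I : {set 'I_n} | (#|I| == j) && (i0 \in I)]%SET| = 'C(n.-1, j.-1).
  have := card_draws 'I_n j; rewrite card_ord.
  have n0 : (0 < n)%N by exact: leq_ltn_trans (leq0n i0) (ltn_ord i0).
  have binE a b : (0 < a)%N -> (0 < b)%N -> 'C(a, b) = ('C(a.-1, b) + 'C(a.-1, b.-1))%N.
    by case: a => // a; case: b => // b _ _; exact: binS.
  (* By Pascal's rule, removing the subsets that avoid [i0] from all ['C(n, j)] subsets leaves the
     required number. *)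
  rewrite binE// -card1.
  rewrite -(cardsID [set I : {set 'I_n} | i0 \in I]%SET).
  have -> : [set A : {set 'I_n} | #|A| == j]%SET :\: [set I : {set 'I_n} | i0 \in I]%SET =
     [set I : {set 'I_n} | (#|I| == j) && (i0 \notin I)]%SET.
    by apply/setP => I; rewrite !inE andbC.
  rewrite addnC => /addnI <-; apply: eq_card => I; by rewrite !inE.
congr (_ + _).
  rewrite (eq_bigr (fun=> q ^+ j)) => [|I /andP[/eqP <- i0I]].
    by rewrite -card1 -sum1_card natr_sum mulr_suml; apply: eq_big => [I|I _]; rewrite ?inE// mul1r.
  rewrite -prodr_const; apply: eq_bigr => i iI; rewrite mxE.
  by case: eqP => // ii0; rewrite -ii0 iI in i0I.
rewrite (eq_bigr (fun=> p * q ^+ j.-1)) => [|I /andP[/eqP <- i0I]].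
  by rewrite -card2 -sum1_card natr_sum mulr_suml; apply: eq_big => [I|I _]; rewrite ?inE// mul1r.
rewrite (bigD1 i0)//= mxE eqxx; congr (_ * _).
rewrite (eq_bigr (fun=> q)) => [|i /andP[_ /negbTE ii0]]; last by rewrite mxE ii0.
rewrite prodr_const; congr (_ ^+ _).
by rewrite (cardD1 i0 I) i0I/= ; apply: eq_card => i; rewrite !inE andbC.
Qed.

(** * Kronecker symbols, coordinate functions and points on a coordinate axis *)

Definition kron {R : realType} {n : nat} (i j : 'I_n) : R := (i == j)%:R.

Lemma kron_refl {R : realType} n (i : 'I_n) : kron i i = 1 :> R.
Proof. by rewrite /kron eqxx. Qed.

Lemma kron_sym {R : realType} n (i j : 'I_n) : kron i j = kron j i :> R.
Proof. by rewrite /kron eq_sym. Qed.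

Lemma sum_kron (R : realType) n (F : 'I_n -> R) j : \sum_l kron l j * F l = F j.
Proof.
rewrite (bigD1 j)//= kron_refl mul1r big1 ?addr0// => i ij.
by rewrite /kron (negbTE ij) mul0r.
Qed.

Lemma is_derive_coord (R : realType) n (x : 'rV[R]_n) (i j : 'I_n) :
  is_derive x (delta_mx 0 j : 'rV[R]_n) (fun y => y 0 i) (kron i j).
Proof.
apply: is_derive_line.
rewrite (_ : (fun h => _) = fun h => kron i j * h + x 0 i); last first.
  by apply/funext => h; rewrite !mxE/= mulrC.
by apply: is_derive_eq; rewrite /GRing.scale/=; ring.
Qed.

Lemma partial_radial (R : realType) n (G G1 : R -> R) (x : 'rV[R]_n) i :
  (forall s : R, is_derive s 1 G (G1 s)) -> x != 0 ->
  partial i (fun y => G (ln (enorm y))) x =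
    x 0 i * (expR (- 2 * ln (enorm x)) * G1 (ln (enorm x))).
Proof.
move=> HG x0; rewrite /partial; have [_ ->] := is_derive_radial i x0 (HG _).
by rewrite -exprVn -{1}[enorm x]lnK ?posrE ?enorm_gt0// -expRN -expRM_natl mulrN mulNr.
Qed.

Lemma is_derive_coord_radial (R : realType) n (G G1 : R -> R) (x : 'rV[R]_n) (i j : 'I_n) :
  (forall s : R, is_derive s 1 G (G1 s)) -> x != 0 ->
  is_derive x (delta_mx 0 j : 'rV[R]_n) (fun y => y 0 i * G (ln (enorm y)))
    (kron i j * G (ln (enorm x)) +
      x 0 i * x 0 j * (expR (- 2 * ln (enorm x)) * G1 (ln (enorm x)))).
Proof.
move=> HG x0; have HG' := is_derive_radial j x0 (HG _).
have Hc := is_derive_coord x i j.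
apply: is_derive_eq.
rewrite /GRing.scale/= -exprVn -{1}[enorm x]lnK ?posrE ?enorm_gt0// -expRN -expRM_natl.
by rewrite mulrN mulNr; ring.
Qed.

Lemma axis_neq0 (R : realType) n (i0 : 'I_n) (s : R) :
  expR s *: delta_mx 0 i0 != 0 :> 'rV[R]_n.
Proof.
rewrite scaler_eq0 gt_eqF ?expR_gt0//=; apply/eqP => /rowP/(_ i0)/eqP.
by rewrite !mxE !eqxx/= oner_eq0.
Qed.

Lemma ln_enorm_axis (R : realType) n (i0 : 'I_n) (s : R) :
  ln (enorm (expR s *: delta_mx 0 i0 : 'rV[R]_n)) = s.
Proof. by rewrite enorm_axis ?expR_ge0// expRK. Qed.

Lemma axis_coord (R : realType) n (i0 i : 'I_n) (c : R) :
  (c *: delta_mx 0 i0 : 'rV[R]_n) 0 i = c * kron i i0.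
Proof. by rewrite !mxE. Qed.

(** Rotationally invariant symmetric tensors take this diagonal form on the axis [i0], with [p] the
    radial eigenvalue and [q] the tangential one. *)
Lemma sigma_axial (R : realType) n (i0 : 'I_n) (A : 'M[R]_n) j p q :
  (0 < j <= n)%N ->
  (forall i l, A i l = kron i l * q + kron i i0 * kron l i0 * (p - q)) ->
  sigma j A = sym_axial n j p q.
Proof.
move=> /andP[j0 jn] AE; transitivity (elem_sym j (\row_i if i == i0 then p else q)); last exact: elem_sym_axial.
transitivity (sigma j (diag_mx (\row_i if i == i0 then p else q))); last exact: sigma_diag.
congr (sigma j _); apply/matrixP => i l; rewrite AE !mxE.
rewrite /kron; case: (eqVneq i l) => [<-|il].
  by case: eqP => _ /=; rewrite ?mulr1n; ring.
rewrite mulr0n; case: (eqVneq i i0) => [ii0|]; last by move=> _ /=; ring.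
by case: (eqVneq l i0) => [li0|_ /=]; [rewrite ii0 li0 eqxx in il|ring].
Qed.

Lemma sym_axial_scale (R : realType) n j (c p q : R) : (0 < j)%N ->
  sym_axial n j (c * p) (c * q) = c ^+ j * sym_axial n j p q.
Proof.
by case: j => // j _; rewrite /sym_axial/= !exprMn !exprS; ring.
Qed.

(** * Schouten tensor of a radial conformally flat metric *)

Section ConformallyFlat.
Context {R : realType} {n : nat}.

(* The Christoffel symbols of [e^(2 W) |dx|^2] when [w] is the gradient of [W]. *)
Definition flat_christoffel (w : 'I_n -> R) (l i j : 'I_n) : R :=
  w i * kron l j + w j * kron l i - w l * kron i j.

(** The algebra behind the conformal change of the Ricci tensor: [M l i] stands for the derivative
    of [w i] in direction [l], and the left side is the coordinate formula with the Christoffel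
    symbols inserted. *)
Lemma flat_ricci (w : 'I_n -> R) (M : 'I_n -> 'I_n -> R) i j :
  \sum_l ((kron l j * M l i + kron l i * M l j - kron i j * M l l)
      - (kron l l * M j i + kron l i * M j l - kron i l * M j l)
      + \sum_p (flat_christoffel w l l p * flat_christoffel w p i j
             - flat_christoffel w l j p * flat_christoffel w p i l))
  = M j i + M i j - n%:R * M j i + (n%:R - 2) * (w i * w j)
    - kron i j * (\sum_l M l l + (n%:R - 2) * \sum_l w l ^+ 2).
Proof.
set N := \sum_l w l ^+ 2; set T := \sum_l M l l.
have G1 l p : flat_christoffel w l l p = w p.
  by rewrite /flat_christoffel kron_refl; ring.
have G2 i' j' : \sum_p w p * flat_christoffel w p i' j' =
    2 * (w i' * w j') - kron i' j' * N.
  rewrite (eq_bigr (fun p => kron p j' * (w i' * w p) + kron p i' * (w j' * w p)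
     - kron i' j' * w p ^+ 2)); last by move=> p _; rewrite /flat_christoffel; ring.
  by rewrite sumrB big_split/= !sum_kron -mulr_sumr -/N; ring.
have G3 l : \sum_p (flat_christoffel w l l p * flat_christoffel w p i j
             - flat_christoffel w l j p * flat_christoffel w p i l)
   = 2 * (w i * w j) - kron i j * N
     - (w i * w j + kron l j * (2 * (w i * w l)) - kron l j * (kron i l * N))
     + kron l j * (w l * w i) + kron i j * w l ^+ 2 - kron l i * (w l * w j).
  rewrite (eq_bigr (fun p => w p * flat_christoffel w p i j
     - kron p l * (w j * flat_christoffel w p i l)
     - kron l j * (w p * flat_christoffel w p i l)
     + kron p j * (w l * flat_christoffel w p i l))); last first.
    move=> p _; rewrite G1 [flat_christoffel w l j p]/flat_christoffel (kron_sym p l) (kron_sym p j); ring.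
  rewrite !(big_split, sumrB)/= !sumrN !sum_kron -mulr_sumr !G2.
  rewrite /flat_christoffel kron_refl (kron_sym j l) (kron_sym j i) (kron_sym i l); ring.
rewrite (eq_bigr (fun l => kron l j * M l i + kron l i * M l j - kron i j * M l l
   - M j i + (2 * (w i * w j) - kron i j * N - w i * w j)
   - kron l j * (2 * (w i * w l)) + kron l j * (kron i l * N)
   + kron l j * (w l * w i) + kron i j * w l ^+ 2 - kron l i * (w l * w j))); last first.
  by move=> l _; rewrite G3 kron_refl (kron_sym i l); ring.
rewrite !(big_split, sumrB, sumrN)/= !sum_kron -!mulr_sumr.
rewrite !sumr_const card_ord -/N -/T; ring.
Qed.

Context (g : 'rV[R]_n -> 'M[R]_n) (W W1 W2 : R -> R).
Hypothesis HW : forall s : R, is_derive s 1 W (W1 s).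
Hypothesis HW1 : forall s : R, is_derive s 1 W1 (W2 s).
Hypothesis gE : forall x, x != 0 -> g x = (expR (2 * W (ln (enorm x))))%:M.

(** [w] is the gradient of [W (ln |x|)] and [M] its Hessian; [B] is [W1 / |x|^2] written in the
    variable [s = ln |x|], and [B1] its derivative. *)
Let B (s : R) := expR (- 2 * s) * W1 s.
Let B1 (s : R) := expR (- 2 * s) * (W2 s - 2 * W1 s).
Let w (x : 'rV[R]_n) i := x 0 i * B (ln (enorm x)).
Let M (x : 'rV[R]_n) i j := kron i j * B (ln (enorm x)) +
  x 0 i * x 0 j * (expR (- 2 * ln (enorm x)) * B1 (ln (enorm x))).

Let HB (s : R) : is_derive s 1 B (B1 s).
Proof.
have := HW1 s => ?; rewrite /B; apply: is_derive_eq.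
by rewrite /B1 /GRing.scale/=; ring.
Qed.

Lemma partial_metric x i p j : x != 0 ->
  partial i (fun y => g y p j) x =
    2 * w x i * expR (2 * W (ln (enorm x))) * kron p j.
Proof.
move=> x0.
rewrite (@partial_ext _ _ _ (fun y => kron p j * expR (2 * W (ln (enorm y)))))//; last first.
  by move=> y y0; rewrite gE// mxE /kron !mulr_natl.
have HG (s : R) : is_derive s 1 (fun s => kron p j * expR (2 * W s))
    (kron p j * expR (2 * W s) * (2 * W1 s)).
  by have := HW s => ?; apply: is_derive_eq; rewrite /GRing.scale/=; ring.
rewrite [LHS](partial_radial i HG x0).
by rewrite /w /B; ring.
Qed.

Lemma christoffel_conformal x l i j : x != 0 ->
  christoffel g l i j x = flat_christoffel (w x) l i j.
Proof.
move=> x0; rewrite /christoffel.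
rewrite (eq_bigr (fun p => kron p l * (2 * flat_christoffel (w x) p i j))).
  by rewrite sum_kron mulrA mulVf ?mul1r// pnatr_eq0.
move=> p _; rewrite !partial_metric// gE// invmx_scalar mxE -[_ *+ (l == p)]mulr_natl -/(kron l p) (kron_sym l p).
rewrite /flat_christoffel.
have := expR_gt0 (2 * W (ln (enorm x))); set e := expR _ => e0.
by field; rewrite gt_eqF.
Qed.

(** The symbols are linear in [w] with constant coefficients, so differentiation replaces [w] by
    [M]. *)
Lemma partial_christoffel x q l i j : x != 0 ->
  partial q (christoffel g l i j) x =
  kron l j * M x q i + kron l i * M x q j - kron i j * M x q l.
Proof.
move=> x0; rewrite (partial_ext _ x0 (fun y y0 => christoffel_conformal l i j y0)).
have H1 := is_derive_coord_radial i q HB x0.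
have H2 := is_derive_coord_radial j q HB x0.
have H3 := is_derive_coord_radial l q HB x0.
pose f (y : 'rV[R]_n) := kron l j * (y 0 i * B (ln (enorm y)))
  + kron l i * (y 0 j * B (ln (enorm y))) - kron i j * (y 0 l * B (ln (enorm y))).
have -> : (fun y => flat_christoffel (w y) l i j) = f.
  by apply/funext => y; rewrite /flat_christoffel /w /f; ring.
have [_ E] : is_derive x (delta_mx 0 q : 'rV[R]_n) f
    (kron l j * M x q i + kron l i * M x q j - kron i j * M x q l).
  by apply: is_derive_eq; rewrite /M /GRing.scale/= !(kron_sym q); ring.
exact: E.
Qed.

Lemma ricci_conformal x i j : x != 0 ->
  ricci g x i j = (2 - n%:R) * M x i j + (n%:R - 2) * (w x i * w x j)
    - kron i j * (\sum_l M x l l + (n%:R - 2) * \sum_l w x l ^+ 2).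
Proof.
move=> x0; rewrite mxE.
under eq_bigr => l _.
  rewrite !partial_christoffel//.
  under eq_bigr => p _ do rewrite !christoffel_conformal//.
  over.
rewrite flat_ricci.
have -> : M x j i = M x i j by rewrite /M kron_sym; ring.
ring.
Qed.

(** The Laplacian [T] cancels between the Ricci and the scalar curvature terms, which leaves the
    classical transformation law over a flat background. *)
Lemma schouten_conformal x i j : (3 <= n)%N -> x != 0 ->
  schouten g x i j = - M x i j + w x i * w x j
    - kron i j * (2^-1 * \sum_l w x l ^+ 2).
Proof.
move=> n3 x0; set N := \sum_l _; set T := \sum_l M x l l.
have n3R : (3 : R) <= n%:R by rewrite ler_nat.
have Rc : scalar_curvature g x = (expR (2 * W (ln (enorm x))))^-1 *
    ((n%:R - 1) * (- 2 * T - (n%:R - 2) * N)).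
  rewrite /scalar_curvature gE// invmx_scalar mul_scalar_mx mxtraceZ; congr (_ * _).
  rewrite /mxtrace; under eq_bigr => l _ do rewrite ricci_conformal// -expr2 kron_refl.
  rewrite sumrB big_split/= -!mulr_sumr sumr_const card_ord -/N -/T -mulr_natl; ring.
rewrite mxE mxE ricci_conformal// -/N -/T !mxE Rc gE// mxE -[_ *+ (i == j)]mulr_natl -/(kron i j).
have := expR_gt0 (2 * W (ln (enorm x))); set e := expR _ => e0.
field.
by rewrite (gt_eqF e0)/=; apply/andP; split; apply: lt0r_neq0; lra.
Qed.

(** The radial and tangential eigenvalues are read off on the axis. The exponential factor combines
    the inverse metric with the [|x|^-2] produced by the logarithmic coordinate. *)
Lemma sigma_curvature_axis (i0 : 'I_n) s j : (3 <= n)%N -> (0 < j <= n)%N ->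
  sigma_curvature g j (expR s *: delta_mx 0 i0) =
  expR (- 2 * (W s + s)) ^+ j *
    sym_axial n j (W1 s - W2 s + W1 s ^+ 2 / 2) (- W1 s - W1 s ^+ 2 / 2).
Proof.
move=> n3 jn; rewrite /sigma_curvature -sym_axial_scale; last by case/andP: jn.
have x0 := axis_neq0 i0 s.
apply: (@sigma_axial _ _ i0) => // i l.
rewrite gE// invmx_scalar mul_scalar_mx mxE schouten_conformal//.
have -> : \sum_l w (expR s *: delta_mx 0 i0) l ^+ 2 = (expR s * B s) ^+ 2.
  rewrite (eq_bigr (fun l => kron l i0 * (kron l i0 * (expR s * B s) ^+ 2))).
    by rewrite sum_kron kron_refl mul1r.
  by move=> h _; rewrite /w axis_coord ln_enorm_axis; ring.
rewrite /M /w !axis_coord !ln_enorm_axis /B1 /B !mulNr !expRN !expRM_natl expRD.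
have : 0 < expR s by exact: expR_gt0.
have : 0 < expR (W s) by exact: expR_gt0.
move: (expR s) (expR (W s)) => e E E0 e0.
by field; rewrite ?gt_eqF.
Qed.

End ConformallyFlat.

(** * The matrix in the soliton equation *)

Lemma hess_radial_axis (R : realType) n (v : 'rV[R]_n -> R) (G G1 G2 : R -> R)
    (i0 : 'I_n) s i j :
  (forall s : R, is_derive s 1 G (G1 s)) -> (forall s : R, is_derive s 1 G1 (G2 s)) ->
  (forall x, x != 0 -> v x = G (ln (enorm x))) ->
  hess v (expR s *: delta_mx 0 i0) i j = kron i j * (expR (- 2 * s) * G1 s)
    + kron i i0 * kron j i0 * (expR (- 2 * s) * (G2 s - 2 * G1 s)).
Proof.
move=> HG HG1 vE; rewrite mxE.
pose B (s : R) := expR (- 2 * s) * G1 s.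
have HB (t : R) : is_derive t 1 B (expR (- 2 * t) * (G2 t - 2 * G1 t)).
  have := HG1 t => ?; rewrite /B; apply: is_derive_eq.
  by rewrite /GRing.scale/=; ring.
have x0 := axis_neq0 i0 s.
rewrite (@partial_ext _ _ _ (fun y => y 0 j * B (ln (enorm y))))//; last first.
  by move=> y y0; rewrite (partial_ext j y0 vE) (partial_radial j HG y0).
have [_] := is_derive_coord_radial j i HB x0; rewrite /partial => ->.
rewrite !axis_coord ln_enorm_axis /B !mulNr !expRN !expRM_natl (kron_sym j i).
have : 0 < expR s by exact: expR_gt0.
by move: (expR s) => e e0; field; rewrite ?gt_eqF.
Qed.

Lemma grad_radial_axis (R : realType) n (v : 'rV[R]_n -> R) (G G1 : R -> R)
    (i0 : 'I_n) s i :
  (forall s : R, is_derive s 1 G (G1 s)) ->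
  (forall x, x != 0 -> v x = G (ln (enorm x))) ->
  grad v (expR s *: delta_mx 0 i0) 0 i = kron i i0 * (expR (- s) * G1 s).
Proof.
move=> HG vE; have x0 := axis_neq0 i0 s.
rewrite mxE (partial_ext i x0 vE) (partial_radial i HG x0) axis_coord ln_enorm_axis.
rewrite !mulNr !expRN !expRM_natl.
have : 0 < expR s by exact: expR_gt0.
by move: (expR s) => e e0; field; rewrite ?gt_eqF.
Qed.

(** For [v = e^(-W)] the matrix is [e^(-W)] times the Schouten tensor of [e^(2W) |dx|^2], so the
    [sym_axial] of [sigma_curvature_axis] reappears and admissibility controls its sign. *)
Lemma sigma_soliton_axis (R : realType) n (v : 'rV[R]_n -> R) (W W1 W2 : R -> R)
    (i0 : 'I_n) s k : (0 < k <= n)%N ->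
  (forall s : R, is_derive s 1 W (W1 s)) -> (forall s : R, is_derive s 1 W1 (W2 s)) ->
  (forall x, x != 0 -> v x = expR (- W (ln (enorm x)))) ->
  sigma k (hess v (expR s *: delta_mx 0 i0)
    - (expR (W s) / 2 * enorm (grad v (expR s *: delta_mx 0 i0)) ^+ 2)%:M) =
  expR (- W s - 2 * s) ^+ k *
    sym_axial n k (W1 s - W2 s + W1 s ^+ 2 / 2) (- W1 s - W1 s ^+ 2 / 2).
Proof.
move=> kn HW HW1 vE.
pose G1 s := - W1 s * expR (- W s); pose G2 s := (W1 s ^+ 2 - W2 s) * expR (- W s).
have HG (t : R) : is_derive t 1 (fun t => expR (- W t)) (G1 t).
  rewrite /G1 mulrC; apply: is_derive_expRf; exact: is_deriveN (HW t).
have HG1 (t : R) : is_derive t 1 G1 (G2 t).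
  have H1 : is_derive t 1 (fun t => - W1 t) (- W2 t) by exact: is_deriveN (HW1 t).
  by have H2 := HG t; rewrite /G1; apply: is_derive_eq; rewrite /G2 /G1 /GRing.scale/=; ring.
have gradE : enorm (grad v (expR s *: delta_mx 0 i0)) ^+ 2 = (expR (- s) * G1 s) ^+ 2.
  rewrite enorm_sqr /dotv.
  rewrite (eq_bigr (fun l => kron l i0 * (kron l i0 * (expR (- s) * G1 s) ^+ 2))).
    by rewrite sum_kron kron_refl mul1r.
  move=> h _; rewrite (grad_radial_axis i0 s h HG vE).
  by move: (expR (- s) * G1 s) (kron h i0) => a b; ring.
rewrite -sym_axial_scale; last by case/andP: kn.
apply: (@sigma_axial _ _ i0) => // i l.
rewrite mxE (hess_radial_axis i0 s i l HG HG1 vE) mxE mxE gradE.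
rewrite -[_ *+ (i == l)]mulr_natl -/(kron i l) /G1 /G2 !mulNr expRD !expRN !expRM_natl.
have : 0 < expR s by exact: expR_gt0.
have : 0 < expR (W s) by exact: expR_gt0.
move: (expR s) (expR (W s)) => e E E0 e0.
by field; rewrite ?gt_eqF.
Qed.

(** * Logarithmic radial coordinate and consequences of superharmonicity *)

Lemma is_derive_axis (R : realType) n (f : 'rV[R]_n -> R) (e : 'rV[R]_n) (r d : R) :
  is_derive (r *: e) e f d -> is_derive r 1 (fun r => f (r *: e)) d.
Proof.
move=> [Hd Hv].
have E : (fun h : R => h^-1 *: (((fun r => f (r *: e)) \o shift r) (h *: (1 : R)) - f (r *: e)))
  = (fun h : R => h^-1 *: ((f \o shift (r *: e)) (h *: e) - f (r *: e))).
  by apply/funext => h /=; rewrite -[h *: 1]/(h * 1) mulr1 scalerDl.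
by constructor; [rewrite /derivable E|rewrite /derive E].
Qed.

(* The last clause holds because [u] has a bounded radial derivative near 0. *)
Lemma log_radial (R : realType) n (i0 : 'I_n) (u : 'rV[R]_n -> R) :
  (forall x, 0 < u x) -> smooth u -> radially_symmetric u ->
  exists om om1 om2 : R -> R,
  [/\ forall s : R, is_derive s 1 om (om1 s),
      forall s : R, is_derive s 1 om1 (om2 s),
      forall x, x != 0 -> u x = expR (om (ln (enorm x)))
    & exists S M, forall s, s <= S -> om s <= M /\ om1 s <= M * expR s].
Proof.
move=> u0 us ur; pose e : 'rV[R]_n := delta_mx 0 i0.
pose U r := u (r *: e); pose U1 r := partial i0 u (r *: e).
pose U2 r := partial i0 (partial i0 u) (r *: e).
have dU (r : R) : is_derive r 1 U (U1 r).
  apply: is_derive_axis; apply: DeriveDef => //.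
  by apply: diff_derivable; exact: (us [::]).
have dU1 (r : R) : is_derive r 1 U1 (U2 r).
  apply: (@is_derive_axis _ _ (partial i0 u)); apply: DeriveDef => //.
  by apply: diff_derivable; exact: (us [:: i0]).
pose om s := ln (U (expR s)).
pose om1 s := expR s * (U1 (expR s) / U (expR s)).
have dUe (s : R) : is_derive s 1 (fun s => U (expR s)) (U1 (expR s) * expR s).
  exact: (is_derive1_comp (f := U)).
have dU1e (s : R) : is_derive s 1 (fun s => U1 (expR s)) (U2 (expR s) * expR s).
  exact: (is_derive1_comp (f := U1)).
have dom (s : R) : is_derive s 1 om (om1 s).
  apply: is_derive_eq.
    apply: (is_derive1_comp (f := @ln R)).
    by apply: is_derive1_ln; exact: u0.
  by rewrite /om1; ring.
pose om2 s := om1 s + expR s ^+ 2 *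
  (U2 (expR s) / U (expR s) - (U1 (expR s) / U (expR s)) ^+ 2).
have dom1 (s : R) : is_derive s 1 om1 (om2 s).
  have Un0 : U (expR s) != 0 by rewrite gt_eqF// u0.
  have H := is_deriveV (f := fun s => U (expR s)) Un0 (dUe s).
  rewrite /om1; apply: is_derive_eq; rewrite /GRing.scale/= /om2 /om1.
  by field.
exists om, om1, om2; split => //.
- move=> x x0; rewrite /om lnK ?posrE ?u0// lnK ?posrE ?enorm_gt0//.
  by apply: ur; rewrite enorm_axis ?sqrtr_ge0.
have cU : U r @[r --> (0 : R)] --> U 0.
  by apply: differentiable_continuous; apply/derivable1_diffP; exact: ex_derive.
have cU1 : U1 r @[r --> (0 : R)] --> U1 0.
  by apply: differentiable_continuous; apply/derivable1_diffP; exact: ex_derive.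
have a0 : 0 < U 0 by exact: u0.
have : \forall r \near (0 : R), [/\ U 0 / 2 < U r, U r < U 0 + 1 & U1 r < `|U1 0| + 1].
  near=> r; split; near: r.
  - by apply: (cvgr_gt _ cU); lra.
  - by apply: (cvgr_lt _ cU); lra.
  - by apply: (cvgr_lt _ cU1); have := ler_norm (U1 0); lra.
move=> /nbhs_ballP[d /= d0 Hd].
(* The first witness keeps [expR s] inside the ball of radius [d]. The entries of the maximum bound
   [ln U] and the quotient [U1 / U], whose denominator exceeds [U 0 / 2]. *)
exists (ln (d / 2)), (Num.max (ln (U 0 + 1)) ((`|U1 0| + 1) / (U 0 / 2))) => s sd.
have {Hd} [U1b U2b U3b] : [/\ U 0 / 2 < U (expR s), U (expR s) < U 0 + 1
    & U1 (expR s) < `|U1 0| + 1].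
  apply: Hd; rewrite /ball/= sub0r normrN gtr0_norm ?expR_gt0//.
  apply: (@le_lt_trans _ _ (d / 2)); last by lra.
  by rewrite -[leRHS]lnK ?posrE ?divr_gt0// ler_expR.
have Up : 0 < U (expR s) by exact: u0.
split.
  by rewrite le_max /om ler_ln ?posrE//; [rewrite (ltW U2b)|lra].
rewrite /om1 mulrC ler_pM2r ?expR_gt0// le_max; apply/orP; right.
rewrite ler_pdivrMr//.
apply: (le_trans (ltW U3b)); rewrite mulrAC ler_pdivlMr; last lra.
by rewrite ler_pM2l ?(ltW U1b)// ltr_wpDl.
Unshelve. all: by end_near. Qed.

(* [e^(gam W)] is, for [gam = (n - 2) / 2], the power of the conformal factor
   whose Laplacian is a negative multiple of the scalar curvature of [g_u]. With
   [w := e^(gam W)] and [r := e^s], superharmonicity makes both [r^(n-1) w'] and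
   the derivative of [r^(n-2) w] monotone. *)
Section Superharmonic.
Context {R : realType} (W W1 W2 : R -> R) (gam : R).
Hypothesis HW : forall s : R, is_derive s 1 W (W1 s).
Hypothesis HW1 : forall s : R, is_derive s 1 W1 (W2 s).
Hypothesis gam_gt0 : 0 < gam.
Hypothesis superharmonic : forall s, W2 s + gam * (2 * W1 s + W1 s ^+ 2) <= 0.

(** If [W1 s0 > 0], the nonincreasing [Z], a multiple of [r^(n-1) w'], stays above [Z s0 > 0] as [s]
    tends to minus infinity, whereas the bounds near the origin make it at most [C * expR s]. *)
Lemma superharmonic_decreasing (S M : R) :
  (forall s, s <= S -> W s <= M /\ W1 s <= M * expR s) ->
  forall s, W1 s <= 0.
Proof.
move=> HM s0; rewrite leNgt; apply/negP => W1s0; have g0 := gam_gt0.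
pose Z s := expR (2 * gam * s + gam * W s) * W1 s.
have dZ (s : R) : is_derive s 1 Z (expR (2 * gam * s + gam * W s) *
    (W2 s + gam * (2 * W1 s + W1 s ^+ 2))).
  have := HW s => ?; have := HW1 s => ?; rewrite /Z; apply: is_derive_eq.
  by rewrite /GRing.scale/=; ring.
have Zge s : s <= s0 -> Z s0 <= Z s.
  apply: (nonincreasing_derive dZ) => x _.
  by rewrite pmulr_rle0 ?expR_gt0.
have Z0 : 0 < Z s0 by rewrite mulr_gt0 ?expR_gt0.
pose C := (`|M| + 1) * expR (gam * M).
have C0 : 0 < C by rewrite mulr_gt0 ?expR_gt0// ltr_wpDl.
(* The four bounds serve, in order, the hypothesis [HM], the estimate [expR (2 * gam * s) <= 1], the
   monotonicity of [Z], and [C * expR s < Z s0]. *)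
pose s := Num.min (Num.min S 0) (Num.min s0 (ln (Z s0 / C) - 1)).
have /andP[/andP[sS s00] /andP[ss0 sZ]] : (s <= S) && (s <= 0) && ((s <= s0) && (s <= ln (Z s0 / C) - 1)).
  by rewrite -!le_min lexx.
have := Zge s ss0; apply/negP; rewrite -ltNge.
have [WM W1M] := HM s sS.
have es : expR s < Z s0 / C.
  rewrite -[X in _ < X]lnK ?posrE ?divr_gt0// ltr_expR; lra.
rewrite ltr_pdivlMr// in es; apply: le_lt_trans es.
have W1M' : W1 s <= (`|M| + 1) * expR s.
  apply: le_trans W1M _; rewrite ler_pM2r ?expR_gt0//.
  by have := ler_norm M; lra.
rewrite /Z expRD /C.
have e1 : expR (2 * gam * s) <= 1.
  by rewrite -expR0 ler_expR mulr_ge0_le0// mulr_ge0// ltW.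
have e2 : expR (gam * W s) <= expR (gam * M) by rewrite ler_expR ler_pM2l.
have e3 : expR (2 * gam * s) * expR (gam * W s) <= expR (gam * M).
  by apply: le_trans e2; rewrite ler_piMl ?expR_ge0.
rewrite [leRHS](_ : _ = expR (gam * M) * ((`|M| + 1) * expR s)); last by ring.
have [Wn|Wp] := leP (W1 s) 0; last first.
  by apply: ler_pM => //; rewrite ?mulr_ge0 ?expR_ge0// ltW.
apply: (@le_trans _ _ 0).
  by rewrite mulr_ge0_le0// mulr_ge0 ?expR_ge0.
by rewrite !mulr_ge0 ?expR_ge0// addr_ge0.
Qed.

(** If [2 + W1] is negative at [s0], the nonincreasing [J] stays below [J s0 < 0]; then the positive
    function [P], which is [r^(n-2) w], decreases at least linearly, which is absurd. *)
Lemma superharmonic_decay s : -2 <= W1 s.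
Proof.
move: s => s0; rewrite leNgt; apply/negP => W1s0; have g0 := gam_gt0.
pose J s := expR (gam * W s) * (2 + W1 s).
have dJ (s : R) : is_derive s 1 J (expR (gam * W s) *
    (W2 s + gam * (2 * W1 s + W1 s ^+ 2))).
  have := HW s => ?; have := HW1 s => ?; rewrite /J; apply: is_derive_eq.
  by rewrite /GRing.scale/=; ring.
have Jle s : s0 <= s -> J s <= J s0.
  apply: (nonincreasing_derive dJ) => x _.
  by rewrite pmulr_rle0 ?expR_gt0.
have J0 : J s0 < 0 by rewrite pmulr_rlt0 ?expR_gt0//; lra.
pose P s := expR (gam * W s + 2 * gam * s).
pose c := gam * expR (2 * gam * s0) * J s0.
have c0 : c < 0 by rewrite nmulr_llt0// mulr_gt0 ?expR_gt0.
have dP (s : R) : is_derive s 1 (fun s => P s - c * s)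
    (gam * expR (2 * gam * s) * J s - c).
  have := HW s => ?; rewrite /P; apply: is_derive_eq.
  by rewrite /GRing.scale/= expRD /J; ring.
(* At this point the line of slope [c] that equals [P s0] at [s0] reaches zero. *)
pose s := s0 + P s0 / - c.
have ss : s0 <= s.
  by rewrite lerDl divr_ge0 ?expR_ge0// oppr_ge0 ltW.
have : P s - c * s <= P s0 - c * s0.
  apply: (nonincreasing_derive dP) => // x /andP[sx _].
  rewrite subr_le0 /c.
  have Jx := Jle x (ltW sx).
  have ex : expR (2 * gam * s0) <= expR (2 * gam * x).
    by rewrite ler_expR ler_pM2l ?mulr_gt0// ltW.
  rewrite -!(mulrA gam) ler_pM2l//.
  have := expR_gt0 (2 * gam * s0); nra.
have cs : c * s = c * s0 - P s0.
  by rewrite /s; field; rewrite lt_eqF.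
rewrite cs; have := expR_gt0 (gam * W s + 2 * gam * s); rewrite -/(P s); lra.
Qed.

End Superharmonic.


(** * Growth bounds from the differential inequality *)

(** Above the threshold, [y >= 1] and so [y <= y ^+ k]. This is how a large Lyapunov function makes
    the power in [ode] dominate. *)
Lemma le_mul_exp (R : realType) (K D y : R) k : 0 < K -> 0 <= D -> (0 < k)%N ->
  1 + D / K <= y -> D <= K * y ^+ k.
Proof.
move=> K0 D0 k0 Dy; rewrite mulrC -ler_pdivrMr//.
have y1 : 1 <= y by apply: le_trans Dy; rewrite lerDl divr_ge0// ltW.
apply: (@le_trans _ _ y); last by rewrite ler_eXnr.
by apply: le_trans Dy; rewrite lerDr.
Qed.

(* Here [g_u = e^(-2 xi) (ds^2 + g_S)] in the coordinate [s = ln |x|], [g_S] being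
   the round metric of the unit sphere. *)
Section RadialODE.
Context {R : realType} (xi zeta dzeta : R -> R) (k : nat) (K beta z0 : R).
Hypothesis xi_zeta : forall s : R, is_derive s 1 xi (zeta s).
Hypothesis zeta_dzeta : forall s : R, is_derive s 1 zeta (dzeta s).
Hypothesis zeta_bound : forall s, -1 <= zeta s <= 1.
Hypothesis zeta_lt : forall s, zeta s < z0.
Hypothesis K_gt0 : 0 < K.
Hypothesis beta_ge0 : 0 <= beta.
Hypothesis k_gt0 : (0 < k)%N.
Hypothesis ode : forall s,
  K * (expR (- 2 * xi s) * (z0 - zeta s)) ^+ k - beta <= dzeta s.

(** With [z0 = - mu], the derivative [z0 - zeta] of [X] is positive, so [X] stays above [X 0] and
    [expR (- 2 * xi s) >= c * expR (2 * mu * s)]. The base of the power in [ode] is thus at least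
    [c * Y s], and [Y] cannot increase where it is large. *)
Lemma expander_bound : z0 < 0 -> exists C, forall s, 0 <= s -> z0 * s - xi s <= C.
Proof.
have K0 := K_gt0; have beta0 := beta_ge0.
move=> z0lt0; have [mu mu0 muE] : exists2 mu, 0 < mu & z0 = - mu.
  by exists (- z0); rewrite ?oppr_gt0 ?opprK.
pose X s := z0 * s - xi s; pose Y s := expR (2 * mu * s) * (z0 - zeta s).
have dX (s : R) : is_derive s 1 X (z0 - zeta s).
  have := xi_zeta s => ?; rewrite /X; apply: is_derive_eq.
  by rewrite /GRing.scale/=; ring.
have dY (s : R) : is_derive s 1 Y (expR (2 * mu * s) * (2 * mu * (z0 - zeta s) - dzeta s)).
  have := zeta_dzeta s => ?; rewrite /Y; apply: is_derive_eq.
  by rewrite /GRing.scale/=; ring.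
have X0 s : 0 <= s -> X 0 <= X s.
  move=> s0; rewrite -lerN2.
  apply: (@nonincreasing_derive _ (fun s => - X s) (fun s => - (z0 - zeta s)))=> //.
  by move=> t _; rewrite oppr_le0 subr_ge0 ltW.
(* In the derivative of [Y], [4 * mu] majorizes the term [2 * mu * (z0 - zeta s)] that comes from
   the exponential weight. *)
pose D := beta + 4 * mu.
have D0 : 0 <= D by rewrite addr_ge0// mulr_ge0// ltW.
(* [Y] is trapped, so [z0 - zeta], the derivative of [X], decays exponentially. *)
pose c := expR (2 * X 0); have c0 : 0 < c by exact: expR_gt0.
have YM s : 0 <= s -> Y s <= Num.max (Y 0) ((1 + D / K) / c).
  apply: (trapping dY) => {}s s0 YM; rewrite pmulr_rle0 ?expR_gt0//.
  have zb := zeta_bound s; have odes := ode s.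
  suff : D <= K * (expR (- 2 * xi s) * (z0 - zeta s)) ^+ k.
    have : 2 * mu * (z0 - zeta s) <= 4 * mu by rewrite muE; nra.
    rewrite /D; lra.
  apply: le_mul_exp => //; move: YM; rewrite ler_pdivrMr// => /le_trans; apply.
  rewrite /Y mulrAC ler_wpM2r ?subr_ge0 ?(ltW (zeta_lt s))//.
  rewrite /c -expRD ler_expR.
  by have := X0 _ s0; rewrite /X muE; lra.
pose M := Num.max (Y 0) ((1 + D / K) / c).
exists (X 0 + M / (2 * mu)) => s s0.
(* The added exponential has derivative [- M * expR (- (2 * mu) * t)], which offsets the bound on
   [z0 - zeta t] given by [YM]. *)
have dZ (t : R) : is_derive t 1 (fun t => X t + M / (2 * mu) * expR (- (2 * mu) * t))
    (z0 - zeta t - M * expR (- (2 * mu) * t)).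
  have := dX t => ?; apply: is_derive_eq; rewrite /GRing.scale/=.
  by field; rewrite gt_eqF.
have := nonincreasing_derive dZ (a := 0) (b := s).
rewrite mulr0 expR0 mulr1 => H.
have e0 : 0 <= M / (2 * mu) * expR (- (2 * mu) * s).
  rewrite mulr_ge0 ?expR_ge0// divr_ge0 ?mulr_ge0 ?(ltW mu0)//.
  rewrite /M le_max mulr_ge0 ?expR_ge0// subr_ge0 ltW//.
have {}H : X s + M / (2 * mu) * expR (- (2 * mu) * s) <= X 0 + M / (2 * mu).
  apply: H => // t /andP[t0 _]; have := YM t (ltW t0).
  by rewrite -/M mulNr expRN subr_le0 ler_pdivlMr ?expR_gt0// mulrC.
by rewrite -/(X s); lra.
Qed.

Lemma linear_growth (G P : R -> R) (lam M : R) : 0 <= lam ->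
  (forall s : R, is_derive s 1 G (lam * P s)) ->
  (forall s, 0 <= s -> P s <= M) ->
  forall s, 0 <= s -> G s <= G 0 + lam * M * s.
Proof.
move=> lam0 dG PM s s0; rewrite -lerBlDr.
have dH (t : R) : is_derive t 1 (fun t => G t - lam * M * t) (lam * P t - lam * M).
  by have := dG t => ?; apply: is_derive_eq; rewrite /GRing.scale/=; ring.
rewrite -[G 0]subr0 -[X in _ <= _ - X](mulr0 (lam * M)).
apply: (nonincreasing_derive dH) => // t /andP[t0 _].
by rewrite -mulrBr mulr_ge0_le0// subr_le0 PM// ltW.
Qed.

(** The Lyapunov function is, up to the factor [2 * lam], the derivative of
    [expR (- (2 * lam) * xi s)]; trapping the former makes the latter grow at most linearly. *)
Lemma steady_derive (lam s : R) :
  is_derive s 1 (fun s => - zeta s * expR (- (2 * lam) * xi s))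
    (expR (- (2 * lam) * xi s) * (2 * lam * zeta s ^+ 2 - dzeta s)) /\
  is_derive s 1 (fun s => expR (- (2 * lam) * xi s))
    (2 * lam * (- zeta s * expR (- (2 * lam) * xi s))).
Proof.
have := xi_zeta s => ?; have := zeta_dzeta s => ?.
have H : is_derive s 1 (fun s => - zeta s) (- dzeta s) by apply: is_derive_oppf.
by split; apply: is_derive_eq; rewrite /GRing.scale/=; ring.
Qed.

(** For [z0 = 0] and [lam = 1] the base of the power in [ode] is exactly [P]. The 2 in [beta + 2]
    bounds [2 * zeta s ^+ 2]. *)
Lemma steady_bound : z0 = 0 ->
  exists C, forall s, 0 <= s -> expR (- 2 * xi s) <= C * (1 + s).
Proof.
have K0 := K_gt0; have beta0 := beta_ge0.
move=> z00; pose P s := - zeta s * expR (- (2 * 1) * xi s).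
have dP s := (steady_derive 1 s).1; have dG s := (steady_derive 1 s).2.
have D0 : 0 <= beta + 2 by lra.
have PM s : 0 <= s -> P s <= Num.max (P 0) (1 + (beta + 2) / K).
  apply: (trapping dP) => {}s s0 PM; rewrite pmulr_rle0 ?expR_gt0//.
  have := le_mul_exp K_gt0 D0 k_gt0 PM.
  have := ode s.
  have -> : expR (- 2 * xi s) * (z0 - zeta s) = - zeta s * expR (- (2 * 1) * xi s).
    by rewrite z00 sub0r mulrC mulr1.
  move=> odes Ps.
  have zb := zeta_bound s.
  suff : zeta s ^+ 2 <= 1 by lra.
  nra.
have G := linear_growth (lam := 2 * 1) _ dG PM.
set M := Num.max _ _ in G.
exists (expR (- 2 * xi 0) + 2 * M) => s s0.
have M0 : 0 <= M.
  rewrite /M le_max mulr_ge0 ?expR_ge0// oppr_ge0.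
  by have := zeta_lt 0; rewrite z00 => /ltW.
have := G _ s s0; rewrite mulr1 => /(_ (ler0n _ 2)).
have := expR_ge0 (- 2 * xi 0); nra.
Qed.

(** The exponent [lam = k / (k - 1)] is the one for which the power in [ode] equals
    [- zeta * P ^+ k.-1]. As [beta = 0], the competing term [2 * lam * zeta ^+ 2] also carries a
    factor [- zeta], so it suffices that [K * P ^+ k.-1] exceed [2 * lam]. *)
Lemma steady_bound_critical : z0 = 0 -> beta = 0 -> (1 < k)%N ->
  exists C, forall s, 0 <= s ->
    expR (- (2 * (k%:R / k.-1%:R)) * xi s) <= C * (1 + s).
Proof.
have K0 := K_gt0; have beta0 := beta_ge0.
move=> z00 b0 k1; set lam : R := _ / _; pose P s := - zeta s * expR (- (2 * lam) * xi s).
have k10 : (0 < k.-1)%N by rewrite -ltnS prednK.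
have k10R : 0 < k.-1%:R :> R by rewrite ltr0n.
have lam0 : 0 < lam by rewrite divr_gt0 ?ltr0n.
have dP s := (steady_derive lam s).1; have dG s := (steady_derive lam s).2.
have D0 : 0 <= 2 * lam by lra.
have PM s : 0 <= s -> P s <= Num.max (P 0) (1 + (2 * lam) / K).
  apply: (trapping dP) => {}s s0 PM; rewrite pmulr_rle0 ?expR_gt0//.
  have := le_mul_exp K_gt0 D0 k10 PM; have := ode s.
  rewrite z00 sub0r b0 subr0 -[k in _ ^+ k](prednK k_gt0) exprS => odes Ps.
  have zb := zeta_bound s.
  have h0 : 0 <= - zeta s by have := zeta_lt s; rewrite z00 oppr_ge0 => /ltW.
  have E : (expR (- 2 * xi s) * - zeta s) * (expR (- 2 * xi s) * - zeta s) ^+ k.-1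
      = - zeta s * (- zeta s * expR (- (2 * lam) * xi s)) ^+ k.-1.
    rewrite -exprS prednK// !exprMn -[k in (- zeta s) ^+ k](prednK k_gt0) exprS.
    rewrite -!expRM_natl (_ : k.-1%:R * (- (2 * lam) * xi s) = k%:R * (- 2 * xi s)).
      by ring.
    by rewrite /lam; field; rewrite gt_eqF.
  move: odes; rewrite E.
  set Q := (_ ^+ k.-1) in Ps * => odes.
  have : 2 * lam * - zeta s <= K * Q by nra.
  nra.
have G := linear_growth (lam := 2 * lam) _ dG PM.
set M := Num.max _ _ in G.
exists (expR (- (2 * lam) * xi 0) + 2 * lam * M) => s s0.
have M0 : 0 <= M.
  rewrite /M le_max mulr_ge0 ?expR_ge0// oppr_ge0.
  by have := zeta_lt 0; rewrite z00 => /ltW.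
have := G D0 s s0.
have := expR_ge0 (- (2 * lam) * xi 0).
have : 0 <= 2 * lam * M by rewrite mulr_ge0.
nra.
Qed.

(** Let [L] be large. If [zeta <= z0 / 2], then [ode] gives [dzeta >= 2 / e], and [- e * dzeta]
    beats [- 2 * zeta <= 2]. Otherwise [- 2 * zeta < - z0], which beats
    [- e * dzeta <= e * beta]. *)
Lemma shrinker_bound : 0 < z0 -> exists C, forall s, 0 <= s -> - 2 * xi s <= C.
Proof.
have K0 := K_gt0; have beta0 := beta_ge0.
(* This [e] is small enough for [e * beta <= z0]. *)
move=> z0gt0; pose e := z0 / (beta + 1).
have b1 : 0 < beta + 1 by lra.
have e0 : 0 < e by rewrite divr_gt0.
have eb : e * beta <= z0 by rewrite /e mulrAC ler_pdivrMr//; nra.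
pose L s := - 2 * xi s - e * zeta s.
have dL (s : R) : is_derive s 1 L (- 2 * zeta s - e * dzeta s).
  have := xi_zeta s => ?; have := zeta_dzeta s => ?; rewrite /L; apply: is_derive_eq.
  by rewrite /GRing.scale/=; ring.
(* Since [zeta >= -1], [L >= N] gives [- 2 * xi >= 2 * y / z0], and so does its exponential;
   multiplied by [z0 - zeta >= z0 / 2] it is at least [y], the threshold of [le_mul_exp]. *)
pose D := beta + 2 / e; pose y := 1 + D / K; pose N := e + 2 * y / z0.
have D0 : 0 <= D by rewrite addr_ge0// divr_ge0// ltW.
have y0 : 0 < y by rewrite /y ltr_pwDl// divr_ge0// ltW.
have LM s : 0 <= s -> L s <= Num.max (L 0) N.
  apply: (trapping dL) => {}s s0 LN.
  have zb := zeta_bound s; have odes := ode s.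
  have [zs|zs] := leP (zeta s) (z0 / 2).
    suff Dd : D <= K * (expR (- 2 * xi s) * (z0 - zeta s)) ^+ k.
      have : 2 / e <= dzeta s by rewrite /D in Dd; lra.
      by rewrite ler_pdivrMr// mulrC => ?; lra.
    apply: le_mul_exp => //; rewrite -/y.
    have : 2 * y / z0 <= expR (- 2 * xi s).
      apply: le_trans (expR_ge1Dx _).
      by move: LN; rewrite /N /L; nra.
    have := expR_ge0 (- 2 * xi s).
    by rewrite ler_pdivrMr//; nra.
  suff : - beta <= dzeta s by nra.
  apply: le_trans odes; rewrite lerDr mulr_ge0 ?(ltW K_gt0)// exprn_ge0//.
  by rewrite mulr_ge0 ?expR_ge0// subr_ge0 ltW.
exists (Num.max (L 0) N + e) => s s0; have := LM s s0.
by have := zeta_bound s; rewrite {1}/L; nra.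
Qed.

(** As [beta = 0], [ode] makes [zeta] nondecreasing. A positive value that it attains bounds the
    slope of [xi] below from there on and serves as [d]; the bounds on [d] are those on [zeta]. *)
Lemma shrinker_bound_critical : 0 < z0 -> beta = 0 ->
  exists d s1 C, [/\ 0 < d, d <= z0, d <= 1 & forall s, s1 <= s -> d * s - xi s <= C].
Proof.
have K0 := K_gt0; have beta0 := beta_ge0.
move=> z0gt0 b0.
have dz0 s : 0 <= dzeta s.
  apply: le_trans (ode s); rewrite b0 subr0 mulr_ge0 ?(ltW K_gt0)// exprn_ge0//.
  by rewrite mulr_ge0 ?expR_ge0// subr_ge0 ltW.
have mono s t : s <= t -> zeta s <= zeta t.
  move=> st; rewrite -lerN2.
  apply: (@nonincreasing_derive _ (fun s => - zeta s) (fun s => - dzeta s))=> //.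
  by move=> x _; rewrite oppr_le0.
(* If [zeta] stayed nonpositive, [xi] would not increase, so that [ode] would
   bound [dzeta] away from 0. *)
have [s1 d0] : exists s1, 0 < zeta s1.
  apply: contrapT => nz; have zle s : zeta s <= 0.
    by rewrite leNgt; apply/negP => zs; apply: nz; exists s.
  pose c := K * (expR (- 2 * xi 0) * z0) ^+ k.
  have c0 : 0 < c by rewrite mulr_gt0// exprn_gt0// mulr_gt0// expR_gt0.
  have cd s : 0 <= s -> c <= dzeta s.
    move=> s0; apply: le_trans (ode s); rewrite b0 subr0 ler_pM2l//.
    apply: lerXn2r; rewrite ?nnegrE ?mulr_ge0 ?expR_ge0 ?(ltW z0gt0) ?subr_ge0 ?(ltW (zeta_lt s))//.
    rewrite ler_pM ?expR_ge0 ?(ltW z0gt0)//; last by have := zle s; lra.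
    rewrite ler_expR; suff : xi s <= xi 0 by lra.
    by apply: (nonincreasing_derive xi_zeta).
  have dH (t : R) : is_derive t 1 (fun t => c * t - zeta t) (c - dzeta t).
    by have := zeta_dzeta t => ?; apply: is_derive_eq; rewrite /GRing.scale/=; ring.
  (* By the time [2 / c], [zeta] would have risen by at least 2 from a value at least -1, against
     [zeta <= 0]. *)
  have s0 : 0 <= 2 / c by rewrite divr_ge0// ltW.
  have := nonincreasing_derive dH (a := 0) (b := 2 / c) _ s0.
  rewrite mulr0 sub0r mulrCA divff ?gt_eqF// mulr1 => H.
  have := H _; have := zle (2 / c); have := zeta_bound 0 => zb zc Hc.
  have : 2 - zeta (2 / c) <= - zeta 0.
    by apply: Hc => t /andP[t0 _]; rewrite subr_le0 cd// ltW.
  lra.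
exists (zeta s1), s1, (zeta s1 * s1 - xi s1); split=> //.
- by rewrite ltW.
- by case/andP: (zeta_bound s1).
move=> s ss.
have dH (t : R) : is_derive t 1 (fun t => zeta s1 * t - xi t) (zeta s1 - zeta t).
  by have := xi_zeta t => ?; apply: is_derive_eq; rewrite /GRing.scale/=; ring.
apply: (nonincreasing_derive dH) => // t /andP[t0 _].
by rewrite subr_le0 mono// ltW.
Qed.

End RadialODE.

(** * Reduction of the soliton equation to the differential inequality *)

(** Everything is evaluated on one coordinate axis, with [W = a * ln u] and [xi = - W - s].
    Admissibility enters at [j = 1], which bounds [zeta], and at [j = k], which makes [F]
    positive. *)
Lemma soliton_ode (R : realType) (n k : nat) (theta rho : R) (u : 'rV[R]_n -> R) :
  let a : R := 2 * k%:R / (n%:R + 2 * k%:R) in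
  (3 <= n)%N -> (1 <= k)%N -> (2 * k <= n)%N -> 0 < theta ->
  (forall x, 0 < u x) -> smooth u -> radially_symmetric u ->
  admissible k u -> soliton_equation k u theta rho ->
  exists xi zeta dzeta : R -> R, exists2 K : R, 0 < K &
  [/\ forall s : R, is_derive s 1 xi (zeta s),
      forall s : R, is_derive s 1 zeta (dzeta s),
      forall s, -1 <= zeta s <= 1,
      forall s, zeta s < rho / (2 * theta)
    & (forall s, K * (expR (- 2 * xi s) * (rho / (2 * theta) - zeta s)) ^+ k
        - (n%:R - 2 * k%:R) / (2 * k%:R) <= dzeta s) /\
      (forall x, x != 0 -> u x = expR (- (xi (ln (enorm x)) + ln (enorm x)) / a))].
Proof.
move=> a n3 k1 kn th0 u0 us ur uadm usol.
have kR : 0 < k%:R :> R by rewrite ltr0n.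
have n3R : 3 <= n%:R :> R by rewrite ler_nat.
have knR : 2 * k%:R <= n%:R :> R by rewrite -natrM ler_nat.
have a0 : 0 < a by rewrite /a divr_gt0//; lra.
have n0 : (0 < n)%N by exact: leq_trans n3.
have k_le_n : (k <= n)%N by apply: leq_trans kn; rewrite mul2n -addnn leq_addr.
pose i0 := Ordinal n0.
have [om [om1 [om2 [dom dom1 uE [S [M HM]]]]]] := log_radial i0 u0 us ur.
pose W s := a * om s; pose W1 s := a * om1 s; pose W2 s := a * om2 s.
have dW (s : R) : is_derive s 1 W (W1 s) by exact: is_derive_scalef.
have dW1 (s : R) : is_derive s 1 W1 (W2 s) by exact: is_derive_scalef.
have gE x : x != 0 -> conformal_metric k u x = (expR (2 * W (ln (enorm x))))%:M.
  move=> x0; rewrite /conformal_metric uE// -expRM /W /a; congr (expR _)%:M; field.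
  by rewrite gt_eqF//; lra.
have adm j s : (1 <= j <= k)%N ->
    0 < sym_axial n j (W1 s - W2 s + W1 s ^+ 2 / 2) (- W1 s - W1 s ^+ 2 / 2).
  move=> jk; have := uadm j jk (expR s *: delta_mx 0 i0).
  rewrite (sigma_curvature_axis dW dW1 gE)//; last first.
    by case/andP: jk => -> /= jk; exact: leq_trans k_le_n.
  by rewrite pmulr_rgt0// exprn_gt0// expR_gt0.
have n1 : n.-1%:R = n%:R - 1 :> R by rewrite -subn1 natrB.
(* The case [j = 1]: the trace [p + (n - 1) q] is positive. *)
have sup s : W2 s + (n%:R - 2) / 2 * (2 * W1 s + W1 s ^+ 2) <= 0.
  have := adm 1%N s; rewrite /= k1 => /(_ isT).
  rewrite /sym_axial/= bin1 bin0 expr1 expr0 n1; lra.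
have gam0 : 0 < (n%:R - 2) / 2 :> R by lra.
have W1le : forall s, W1 s <= 0.
  apply: (superharmonic_decreasing dW dW1 gam0 sup (S := S) (M := a * M)).
  by move=> s /HM[H1 H2]; rewrite -mulrA !ler_pM2l.
have W1ge := superharmonic_decay dW dW1 gam0 sup.
pose q s := - W1 s - W1 s ^+ 2 / 2.
pose F s := 2 * theta + rho + 2 * theta * W1 s.
have main s : (0 < F s) /\
    sym_axial n k (W1 s - W2 s + W1 s ^+ 2 / 2) (q s) =
    (expR (2 * (W s + s)) * F s) ^+ k.
  have axn0 := axis_neq0 i0 s (n := n).
  have := usol (expR s *: delta_mx 0 i0).
  set v := fun x => u x `^ _.
  have vE x : x != 0 -> v x = expR (- W (ln (enorm x))).
    by move=> x0; rewrite /v uE// -expRM /W /a; congr expR; ring.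
  have uaE : u (expR s *: delta_mx 0 i0) = expR (om s) by rewrite uE// ln_enorm_axis.
  have -> : u (expR s *: delta_mx 0 i0) `^ (2 * k%:R / (n%:R + 2 * k%:R)) = expR (W s).
    by rewrite uaE -expRM /W /a mulrC.
  rewrite (sigma_soliton_axis i0 s _ dW dW1 vE); last by rewrite k1.
  have dG (t : R) : is_derive t 1 (fun t => expR (om t)) (expR (om t) * om1 t).
    exact: is_derive_expRf.
  have -> : dotv (expR s *: delta_mx 0 i0) (grad u (expR s *: delta_mx 0 i0)) =
      expR (om s) * om1 s.
    rewrite /dotv (eq_bigr (fun l => kron l i0 * (kron l i0 * (expR (om s) * om1 s)))).
      by rewrite sum_kron kron_refl mul1r.
    move=> l _; rewrite (grad_radial_axis i0 s l dG uE) axis_coord expRN.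
    have := expR_gt0 s; move: (expR s) (expR (om s)) => e E e0; field.
    by rewrite gt_eqF.
  rewrite uaE -expRM -/a -/(q s).
  set Sk := sym_axial _ _ _ _; have Sk0 : 0 < Sk by apply: adm; rewrite k1/=.
  have -> : expR (om s * (a - 1)) * ((2 * theta + rho) * expR (om s) +
      4 * k%:R * theta / (n%:R + 2 * k%:R) * (expR (om s) * om1 s)) = expR (W s) * F s.
    rewrite (_ : om s * (a - 1) = W s - om s); last by rewrite /W; ring.
    rewrite expRD expRN /F /W1 /a.
    have := expR_gt0 (om s); move: (expR (W s)) (expR (om s)) => e E E0; field.
    by rewrite (gt_eqF E0) gt_eqF//; lra.
  (* The root of the positive [y] is positive, which gives the sign of [F]; the equation can then be
     raised to the power [k]. *)
  set y := _ * Sk => yE; have y0 : 0 < y by rewrite mulr_gt0 ?exprn_gt0 ?expR_gt0.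
  have F0 : 0 < F s.
    by rewrite -(pmulr_rgt0 _ (expR_gt0 (W s))) -yE powR_gt0.
  split => //.
  have {}yE : y = (expR (W s) * F s) ^+ k.
    rewrite -yE -powR_mulrn ?powR_ge0// -powRrM mulVf ?gt_eqF// powRr1//.
    exact: ltW.
  have -> : Sk = expR (W s + 2 * s) ^+ k * y.
    rewrite /y mulrA -exprMn -expRD (_ : _ + _ = 0) ?expR0 ?expr1n ?mul1r//; ring.
  rewrite yE -exprMn mulrA -expRD; congr ((expR _ * _) ^+ _); ring.
exists (fun s => - W s - s), (fun s => - W1 s - 1), (fun s => - W2 s).
have c0 : 0 < 'C(n.-1, k.-1)%:R :> R.
  by rewrite ltr0n bin_gt0 -ltnS !prednK.
exists ((2 * theta) ^+ k / 'C(n.-1, k.-1)%:R).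
  by rewrite divr_gt0// exprn_gt0// mulr_gt0.
have FE s : F s = 2 * theta * (rho / (2 * theta) - (- W1 s - 1)).
  by rewrite /F; field; rewrite gt_eqF.
split => //.
- move=> s; have := dW s => ?; have HN := is_derive_oppf (dW s).
  by apply: is_derive_subf; exact: is_derive_id.
- move=> s; have HN := is_derive_oppf (dW1 s).
  by rewrite -[- W2 s]subr0; apply: is_derive_subf; exact: is_derive_cst.
- by move=> s; have := W1le s; have := W1ge s; lra.
- move=> s; have [+ _] := main s; rewrite FE pmulr_rgt0 ?mulr_gt0//; lra.
split; last first.
  move=> x x0; rewrite uE//; congr expR; rewrite /W; field.
  by rewrite gt_eqF.
move=> s; have [F0 E] := main s.
(* The ratio [(n - k) / k] of consecutive binomials, diminished by 1, is the source of the
   coefficient [(n - 2k) / k] of [q s]. *)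
have binE : k%:R * 'C(n.-1, k)%:R = (n%:R - k%:R) * 'C(n.-1, k.-1)%:R :> R.
  have := mul_bin_left n.-1 k.-1; rewrite prednK// => /(congr1 (fun m : nat => m%:R : R)).
  have kn1 : (k.-1 <= n.-1)%N by rewrite -ltnS !prednK.
  by rewrite !natrM natrB// n1 -[k.-1]subn1 (natrB R k1) => ->; congr (_ * _); ring.
have q01 : 0 <= q s <= 1.
  by have := W1le s; have := W1ge s; rewrite /q => w1 w2; apply/andP; split; nra.
have q2 : 2 * q s <= 1 by have := sqr_ge0 (W1 s + 1); rewrite /q; nra.
have symE : sym_axial n k (W1 s - W2 s + W1 s ^+ 2 / 2) (q s) =
    'C(n.-1, k.-1)%:R * (q s ^+ k.-1 *
      (- W2 s + (n%:R - 2 * k%:R) / (2 * k%:R) * (2 * q s))).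
  have binE' : 'C(n.-1, k)%:R = (n%:R - k%:R) / k%:R * 'C(n.-1, k.-1)%:R :> R.
    by rewrite mulrAC -binE mulrAC divff ?mul1r// gt_eqF.
  rewrite /sym_axial binE' -[in q s ^+ k](prednK k1) exprS.
  set Q := q s ^+ _; rewrite (_ : W1 s - W2 s + W1 s ^+ 2 / 2 = - W2 s - q s).
    by field; rewrite gt_eqF.
  by rewrite /q; field.
set X := - W2 s + _ in symE.
have E0 : 0 < (expR (2 * (W s + s)) * F s) ^+ k.
  by rewrite exprn_gt0// mulr_gt0// expR_gt0.
have q0 : 0 <= q s ^+ k.-1 by apply: exprn_ge0; case/andP: q01.
have q1 : q s ^+ k.-1 <= 1 by apply: exprn_ile1; case/andP: q01.
rewrite symE in E.
(* Once [X] is known to be positive, the factor [q s ^+ k.-1 <= 1] may be dropped from the equation,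
   leaving an inequality. *)
have X0 : 0 < X.
  rewrite ltNge; apply/negP => X0; move: E0; rewrite -E ltNge; apply/negP/negPn.
  by rewrite pmulr_rle0// mulr_ge0_le0.
have XE : (expR (2 * (W s + s)) * F s) ^+ k <= 'C(n.-1, k.-1)%:R * X.
  by rewrite -E ler_pM2l// ler_piMl// ltW.
rewrite lerBlDr mulrAC ler_pdivrMr// -exprMn.
have -> : 2 * theta * (expR (- 2 * (- W s - s)) * (rho / (2 * theta) - (- W1 s - 1))) =
    expR (2 * (W s + s)) * F s.
  by rewrite FE mulrCA; congr (expR _ * _); ring.
(* As [2 * q s <= 1], the last term of [X] is at most [(n - 2k) / (2k)]. *)
apply: le_trans XE _; rewrite mulrC ler_pM2r// /X lerD2l ler_piMr//.
by rewrite divr_ge0 ?mulr_ge0// subr_ge0.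
Qed.

(** * From bounds on [xi] to decay rates of [u] *)

Lemma eqO_at_infty (R : realType) n (f g : 'rV[R]_n -> R) (S C : R) :
  (forall x, 0 <= f x) ->
  (forall x, x != 0 -> S <= ln (enorm x) -> f x <= C * g x) ->
  f =O_at_infty g.
Proof.
move=> f0 fg; apply/eqO_exP; exists (`|C| + 1); first by rewrite ltr_wpDl.
exists (expR S) => //= x Sx; rewrite (ger0_norm (f0 x)).
have x0 : 0 < enorm x by apply: lt_trans Sx; exact: expR_gt0.
have xn0 : x != 0.
  by apply: contraTneq x0 => ->; rewrite /enorm /dotv big1 ?sqrtr0 ?ltxx// => i _; rewrite mxE mul0r.
apply: (le_trans (fg x xn0 _)).
  by rewrite -[leLHS]expRK ler_ln ?posrE ?expR_gt0// ltW.
apply: (le_trans (ler_norm _)); rewrite normrM ler_wpM2r//.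
by rewrite lerDl.
Qed.

(** For [s >= 1] the factor [1 + s] is absorbed into [2 * s], so linear growth in [s = ln |x|]
    becomes a pure power of [ln |x|]. *)
Lemma expR_le_powR (R : realType) (C s y p : R) : 1 <= s -> 0 <= p ->
  expR y <= C * (1 + s) -> expR (y * p) <= (2 * C) `^ p * s `^ p.
Proof.
move=> s1 p0 yC; have C0 : 0 <= C.
  by have := expR_gt0 y; rewrite leNgt => ?; apply/negP => C0; nra.
rewrite expRM -powRM; [|lra|lra].
by apply: ge0_ler_powR; rewrite ?nnegrE ?expR_ge0//; nra.
Qed.

Theorem theorem1p3 (R : realType) (n k : nat) (theta rho alpha : R)
  (u : 'rV[R]_n -> R)
  (n_ge3 : (3 <= n)%N) (k_ge1 : (1 <= k)%N) (n_ge2k : (2 * k <= n)%N)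
  (theta_gt0 : 0 < theta) (theta_rho_gt0 : 0 < 2 * theta + rho)
  (alpha_gt0 : 0 < alpha)
  (u_gt0 : forall x, 0 < u x)
  (u_smooth : smooth u)
  (u_radial : radially_symmetric u)
  (u_admissible : admissible k u)
  (u_solution : soliton_equation k u theta rho)
  (u_0 : u 0 = alpha) :
  let m : R := (n%:R - 2 * k%:R) / (n%:R + 2 * k%:R) in
  let delta : R := rho / (theta * (1 - m)) in
  [/\ (* expander *)
      rho < 0 ->
        u =O_at_infty (fun x => enorm x `^ (- (2 / (1 - m)) - delta)),
      (* steady *)
      rho = 0 ->
        ((2 * k < n)%N ->
           u =O_at_infty
             (fun x => (ln (enorm x) / enorm x ^+ 2) `^ (1 / (1 - m)))) /\
        (n = (2 * k)%N ->
           u =O_at_infty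
             (fun x => ln (enorm x) `^ (1 - 2 / n%:R) / enorm x ^+ 2))
    & (* shrinker *)
      0 < rho ->
        [/\ (2 * k < n)%N -> rho <= 2 * theta ->
              u =O_at_infty (fun x => enorm x `^ (- (2 / (1 - m)))),
            (2 * k < n)%N -> 2 * theta < rho ->
              u =O_at_infty (fun x => enorm x `^ (- (2 / (1 - m)))) \/
              u =O_at_infty (fun x => enorm x `^ (- (4 / (1 - m))))
          & n = (2 * k)%N ->
              exists d : R,
                [/\ 0 < d, d <= Num.min (rho / (2 * theta)) 1
                  & u =O_at_infty (fun x => enorm x `^ (- (2 * (1 + d))))]]].
Proof.
set a : R := 2 * k%:R / (n%:R + 2 * k%:R).
have kR : 0 < k%:R :> R by rewrite ltr0n.
have nR : 0 < n%:R :> R by rewrite ltr0n (leq_trans _ n_ge3).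
have a0 : 0 < a by rewrite /a divr_gt0//; lra.
have [xi [zeta [dzeta [K K0 [dxi dzet zb zlt [ode uE]]]]]] :=
  soliton_ode n_ge3 k_ge1 n_ge2k theta_gt0 u_gt0 u_smooth u_radial u_admissible u_solution.
rewrite -/a in uE; set z0 := rho / (2 * theta) in zlt ode.
set beta := (n%:R - 2 * k%:R) / (2 * k%:R) in ode.
have beta0 : 0 <= beta.
  rewrite divr_ge0 ?mulr_ge0// subr_ge0 -natrM ler_nat//.
move=> m delta.
(* This expresses the exponents of the statement by [a], where [g_u = u^(2a) |dx|^2]. *)
have mE : 1 - m = 2 * a by rewrite /m /a; field; rewrite gt_eqF//; lra.
have u_ge0 x : 0 <= u x by rewrite ltW.
have enormE (x : 'rV[R]_n) (p : R) : x != 0 -> enorm x `^ p = expR (ln (enorm x) * p).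
  by move=> x0; rewrite expRM lnK ?posrE ?enorm_gt0.
(* Here [n >= 3] excludes [k = 1], as the exponent [k / (k - 1)] requires. *)
have critical : n = (2 * k)%N -> [/\ beta = 0, a = 1 / 2 & (1 < k)%N].
  move=> nk; split.
  - by rewrite /beta nk natrM subrr mul0r.
  - by rewrite /a nk natrM; field; apply: lt0r_neq0; lra.
  - by rewrite -(ltn_pmul2l (isT : (0 < 2)%N)) -nk.
have shrinker : 0 < rho -> u =O_at_infty (fun x => enorm x `^ (- (2 / (1 - m)))).
  move=> rho0; have z00 : 0 < z0 by rewrite divr_gt0// mulr_gt0.
  have [C HC] := shrinker_bound dxi dzet zb zlt K0 beta0 k_ge1 ode z00.
  apply: (@eqO_at_infty _ _ _ _ 0 (expR (C / (2 * a)))) => // x x0 s0.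
  rewrite uE// enormE// -expRD ler_expR mE.
  have -> : C / (2 * a) + ln (enorm x) * - (2 / (2 * a)) = (C - 2 * ln (enorm x)) / (2 * a).
    by field; rewrite gt_eqF.
  have -> : - (xi (ln (enorm x)) + ln (enorm x)) / a =
      (- 2 * xi (ln (enorm x)) - 2 * ln (enorm x)) / (2 * a).
    by field; rewrite gt_eqF.
  rewrite ler_pM2r; last by rewrite invr_gt0 mulr_gt0.
  by have := HC _ s0; lra.
split.
- move=> rho0; have z00 : z0 < 0 by rewrite /z0 nmulr_rlt0// invr_gt0 mulr_gt0.
  have [C HC] := expander_bound dxi dzet zb zlt K0 beta0 k_ge1 ode z00.
  apply: (@eqO_at_infty _ _ _ _ 0 (expR (C / a))) => // x x0 s0.
  rewrite uE// enormE// -expRD ler_expR /delta mE.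
  have -> : C / a + ln (enorm x) * (- (2 / (2 * a)) - rho / (theta * (2 * a))) =
      (C - z0 * ln (enorm x) - ln (enorm x)) / a.
    by rewrite /z0; field; rewrite !gt_eqF.
  rewrite ler_pM2r ?invr_gt0//; have := HC _ s0; lra.
- move=> rho0; have z00 : z0 = 0 by rewrite /z0 rho0 mul0r.
  split => nk.
    have [C HC] := steady_bound dxi dzet zb zlt K0 beta0 k_ge1 ode z00.
    apply: (@eqO_at_infty _ _ _ _ 1 ((2 * C) `^ (1 / (1 - m)))) => // x x0 s1.
    have s0 : 0 <= ln (enorm x) by apply: le_trans s1.
    have p0 : 0 <= 1 / (1 - m) by rewrite mE divr_ge0// mulr_ge0// ltW.
    have H := expR_le_powR s1 p0 (HC _ s0).
    have -> : (ln (enorm x) / enorm x ^+ 2) `^ (1 / (1 - m)) =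
        ln (enorm x) `^ (1 / (1 - m)) * expR (- ln (enorm x) / a).
      rewrite powRM ?invr_ge0 ?exprn_ge0 ?sqrtr_ge0//; congr (_ * _).
      rewrite -exprVn -{1}[enorm x]lnK ?posrE ?enorm_gt0// -expRN -expRM_natl -expRM mE.
      by congr expR; field; rewrite gt_eqF.
    rewrite uE// mulrA.
    have -> : - (xi (ln (enorm x)) + ln (enorm x)) / a =
        - 2 * xi (ln (enorm x)) * (1 / (1 - m)) + - ln (enorm x) / a.
      by rewrite mE; field; rewrite gt_eqF.
    by rewrite expRD ler_pM2r ?expR_gt0.
  have [b0 aE k1] := critical nk.
  have [C HC] := steady_bound_critical dxi dzet zb zlt K0 beta0 k_ge1 ode z00 b0 k1.
  apply: (@eqO_at_infty _ _ _ _ 1 ((2 * C) `^ (1 - 2 / n%:R))) => // x x0 s1.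
  have s0 : 0 <= ln (enorm x) by apply: le_trans s1.
  have k1R : 1 < k%:R :> R by rewrite ltr1n.
  have p0 : 0 <= 1 - 2 / n%:R :> R.
    by rewrite subr_ge0 ler_pdivrMr// mul1r ler_nat ltnW.
  have H := expR_le_powR s1 p0 (HC _ s0).
  rewrite uE// mulrA.
  have -> : enorm x ^- 2 = expR (- 2 * ln (enorm x)).
    by rewrite -exprVn -{1}[enorm x]lnK ?posrE ?enorm_gt0// -expRN -expRM_natl mulrN mulNr.
  (* In this dimension [1 - 2 / n = (k - 1) / k] is the inverse of [k / (k - 1)], so the product of
     exponents is [- 2 * xi], and [1 / a = 2]. *)
  have -> : - (xi (ln (enorm x)) + ln (enorm x)) / a =
      - (2 * (k%:R / k.-1%:R)) * xi (ln (enorm x)) * (1 - 2 / n%:R) + - 2 * ln (enorm x).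
    have nkR : n%:R = 2 * k%:R :> R by rewrite -natrM -nk.
    rewrite aE nkR -[k.-1]subn1 natrB//; field.
    by apply/andP; split; apply: lt0r_neq0; lra.
  by rewrite expRD ler_pM2r ?expR_gt0.
- move=> rho0; split.
  + by move=> _ _; exact: shrinker.
  + by move=> _ _; left; exact: shrinker.
  move=> nk; have [b0 aE k1] := critical nk.
  have z00 : 0 < z0 by rewrite divr_gt0// mulr_gt0.
  have [d [s1 [C [d0 dz d1 HC]]]] :=
    shrinker_bound_critical dxi dzet zb zlt K0 beta0 ode z00 b0.
  exists d; split => //; first by rewrite le_min dz.
  apply: (@eqO_at_infty _ _ _ _ s1 (expR (2 * C))) => // x x0 ss.
  rewrite uE// enormE// -expRD ler_expR aE invf_div divr1.
  have := HC _ ss; lra.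
Qed.
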